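(* Let $D$ be a division ring which is finite dimensional over its center $F$. For any positive integer $n$ there exists an element $a\in D^{(n)}$, the $n$-th multiplicative derived subgroup of $D$, such that $F(a)$ is a maximal subfield of $D$.
   Context: For a multiplicative group $G$, $(a,b)=aba^{-1}b^{-1}$ denotes the commutator of $a,b\in G$, and for a subgroup $H$ of $G$, $(H,H)$ denotes the subgroup generated by all commutators of elements of $H$. The derived series of $G$ is $G\supseteq G'\supseteq\dots\supseteq G^{(n)}\supseteq\cdots$, where $G^{(1)}=G'=(G,G)$ and $G^{(n+1)}=(G^{(n)},G^{(n)})$ for $n\ge 1$. For a division ring $D$, $D^{*}=D\setminus\{0\}$ is its multiplicative group, and $D^{(n)}$ denotes the $n$-th term $(D^{*})^{(n)}$ of the derived series of $D^{*}$. For $a\in D$, $F(a)$ is the subfield of $D$ generated by $F$ and $a$. A subfield $K$ of $D$ is called a maximal subfield if $K$ is equal to its own centralizer in $D$. Division rings are not assumed to be noncommutative. *)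

(* Defs.v *)
From HB Require Import structures.
From mathcomp Require Import all_boot all_order all_algebra all_field.
From mathcomp Require Import boolp classical_sets.

Set Implicit Arguments.
Unset Strict Implicit.
Unset Printing Implicit Defensive.

Import GRing.Theory.

Local Open Scope classical_set_scope.
Local Open Scope ring_scope.

Definition is_division_ring (D : unitRingType) : Prop :=
  forall x : D, x != 0 -> x \is a GRing.unit.

Definition centralizer (D : unitRingType) (S : set D) : set D :=
  [set x | forall y, S y -> x * y = y * x].

Definition center (D : unitRingType) : set D := centralizer [set: D].
Arguments center D : clear implicits.

Definition Dstar (D : unitRingType) : set D := [set x | x != 0].
Arguments Dstar D : clear implicits.

Definition is_mul_subgroup (D : unitRingType) (H : set D) : Prop :=
  [/\ H `<=` Dstar D, H 1,
      forall x y, H x -> H y -> H (x * y) &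
      forall x, H x -> H x^-1].

Definition mul_commutator (D : unitRingType) (a b : D) : D :=
  a * b * a^-1 * b^-1.

Definition derived_subgroup (D : unitRingType) (H : set D) : set D :=
  smallest (@is_mul_subgroup D)
    [set z | exists x y, [/\ H x, H y & z = mul_commutator x y]].

Fixpoint derived_series (D : unitRingType) (n : nat) : set D :=
  if n is m.+1 then derived_subgroup (@derived_series D m) else Dstar D.
Arguments derived_series D n : clear implicits.

(* Since 0^-1 = 0, closure under inverse needs no side condition. *)
Definition is_subfield (D : unitRingType) (K : set D) : Prop :=
  [/\ K 1,
      forall x y, K x -> K y -> K (x - y),
      forall x y, K x -> K y -> K (x * y),
      forall x, K x -> K x^-1 &
      forall x y, K x -> K y -> x * y = y * x].

Definition is_maximal_subfield (D : unitRingType) (K : set D) : Prop :=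
  is_subfield K /\ K = centralizer K.

Definition base_field (F : fieldType) (D : falgType F) : set D :=
  range (GRing.in_alg D).
Arguments base_field {F} D.

Definition adjoin (F : fieldType) (D : falgType F) (a : D) : set D :=
  smallest (@is_subfield D) (base_field D `|` [set a]).

(* Main.v *)
(* If F is finite, D is commutative by Wedderburn's theorem and a = 1 works. If F
   is infinite, let K be a maximal subfield of D. Letting D act on itself by right
   multiplication gives phi : D -> M_m(K), where m = dim_K D, and an F-basis of D
   is mapped to a K-basis of M_m(K). As F is infinite, phi(D \ {0}) is therefore
   Zariski dense in GL_m(K), and taking commutators shows that the closure of phi(D^(n))
   contains the n-th derived subgroup of GL_m(K). The latter contains every
   transvection, hence the regular unipotent matrix 1 + (superdiagonal), for which
   the first basis vector is cyclic. Cyclicity is an open condition, so the first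
   basis vector is also cyclic for phi(a) for some a in D^(n); the centralizer of
   phi(a) then consists of the polynomials in phi(a) over K, and descending from K
   to F, the centralizer of a in D is F[a]. *)
Require Import Defs.
From HB Require Import structures.
From mathcomp Require Import all_boot all_order all_algebra all_field.
From mathcomp Require Import boolp classical_sets.
From mathcomp Require Import ring.

Set Implicit Arguments.
Unset Strict Implicit.
Unset Printing Implicit Defensive.

Import GRing.Theory.

Local Open Scope ring_scope.

(** * Two-sided multiplication maps and self-centralizing subfields *)

Section Splitting.

Variables (F : fieldType) (D : falgType F).
Hypothesis divD : is_division_ring D.
Hypothesis centerD : center D = base_field D.

Lemma central_scalar (x : D) : (forall y, x * y = y * x) -> exists c : F, x = c%:A.
Proof.
move=> xC; have: center D x by move=> y _.
by rewrite centerD => -[c _ <-]; exists c.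
Qed.

(* A relation with minimal support and one coefficient equal to 1 has central
   coefficients, because commuting it with any y shortens it. *)
Lemma mulmap_independent (k : nat) (Y a : 'I_k -> D) :
    (forall r : 'I_k -> F, \sum_i r i *: Y i = 0 -> forall i, r i = 0) ->
  (forall z, \sum_i a i * z * Y i = 0) -> forall i, a i = 0.
Proof.
move=> freeY; have [s] := ubnP #|[pred i | a i != 0]|.
elim: s a => // s IHs a; rewrite ltnS => le_s rel_a i0; apply/eqP/negPn/negP=> nz_i0.
have Ua := divD nz_i0; pose b i := (a i0)^-1 * a i.
have rel_b z : \sum_i b i * z * Y i = 0.
  transitivity ((a i0)^-1 * \sum_i a i * z * Y i); last by rewrite rel_a mulr0.
  by rewrite mulr_sumr; apply: eq_bigr => i _; rewrite /b !mulrA.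
have b1 : b i0 = 1 by rewrite /b mulVr.
have bC i : exists c : F, b i = c%:A.
  apply: central_scalar => y; apply/eqP; rewrite -subr_eq0; apply/eqP; move: i.
  apply: (IHs (fun i => b i * y - y * b i)).
    apply: leq_trans le_s; rewrite [X in (_ < X)%N](cardD1 i0) inE nz_i0 ltnS.
    apply/subset_leq_card/fintype.subsetP => i; rewrite !inE => nz; apply/andP; split.
      by apply: contraNneq nz => ->; rewrite b1 mul1r mulr1 subrr.
    by apply: contraNneq nz => ai0; rewrite /b ai0 mulr0 mul0r mulr0 subrr.
  move=> z; transitivity (\sum_i b i * (y * z) * Y i - y * \sum_i b i * z * Y i).
    by rewrite mulr_sumr -sumrB; apply: eq_bigr => i _; rewrite !mulrBl !mulrA.
  by rewrite !rel_b mulr0 subr0.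
have [c bE] := choice bC.
have c0 : c i0 = 0.
  apply: freeY; rewrite -[RHS](rel_b 1); apply: eq_bigr => i _.
  by rewrite mulr1 bE mulr_algl.
by move/eqP: b1; rewrite bE c0 scale0r eq_sym oner_eq0.
Qed.

(** If [x] were outside the [F]-span of the [y i], then [x] together with a basis of that span would
    be free, and the hypothesis would become a relation with coefficient 1 at [x], contradicting
    [mulmap_independent]. *)
Lemma mulmap_descent (k : nat) (y a : 'I_k -> D) (x : D) :
    (forall z, z * x = \sum_i a i * z * y i) ->
  exists r : 'I_k -> F, x = \sum_i r i *: y i.
Proof.
move=> rel_x; pose Y := [tuple y i | i < k].
have YE i : y i = Y`_i by rewrite -tnth_nth tnth_mktuple.
have [/coord_span xE|xNY] := boolP (x \in <<Y>>%VS).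
  by exists (coord Y ^~ x); rewrite {1}xE; apply: eq_bigr => i _; rewrite YE.
have [B BE freeB] : exists2 B : seq D, <<B>>%VS = <<Y>>%VS & free B.
  exists (vbasis <<Y>>%VS); first exact: span_basis (vbasisP _).
  exact: basis_free (vbasisP _).
have freexB : free (x :: B) by rewrite free_cons BE xNY.
pose T := in_tuple B; pose T' := in_tuple (x :: B).
have yE i : y i = \sum_j coord T j (y i) *: B`_j.
  by apply: coord_span; rewrite BE memv_span // YE mem_nth ?size_tuple.
(* Coefficients after expanding each [y i] in [B] and moving everything to the side of [x]: index 0
   stands for [x], the others for [B]. *)
pose a' (j : 'I_(size B).+1) : D :=
  if unlift ord0 j is Some j' then - \sum_i coord T j' (y i) *: a i else 1.
suff /(_ ord0)/eqP : forall j, a' j = 0 by rewrite /a' unlift_none oner_eq0.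
apply: (@mulmap_independent _ (fun j => T'`_j)).
  exact (elimT (@freeP _ _ _ T') freexB).
move=> z; rewrite big_ord_recl /= {1}/a' unlift_none mul1r rel_x.
apply/eqP; rewrite addr_eq0 -sumrN; apply/eqP.
transitivity (\sum_i \sum_(j < size B) (coord T j (y i) *: a i) * z * B`_j).
  apply: eq_bigr => i _; rewrite {1}yE mulr_sumr; apply: eq_bigr => j _.
  by rewrite -scalerAr -!scalerAl.
rewrite exchange_big /=; apply: eq_bigr => j _.
by rewrite /a' liftK !mulNr opprK !mulr_suml.
Qed.

(** Take a subspace [U] of maximal dimension among those whose elements commute pairwise. An element
    of its centralizer outside [U] could be adjoined linearly, so [U] equals its centralizer, and
    this makes it a subalgebra. *)
Lemma exists_selfcentralizing_aspace :
  exists K : {aspace D}, K = 'C(K)%VS :> {vspace D}.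
Proof.
pose P (k : nat) := `[< exists U : {vspace D}, (U <= 'C(U))%VS /\ \dim U = k >].
have P0 : exists k, P k.
  exists 0; apply/asboolP; exists 0%VS; split; [exact: sub0v|exact: dimv0].
have Pub k : P k -> (k <= \dim {:D})%N.
  by move=> /asboolP[U [_ <-]]; rewrite dimvS ?subvf.
case: (ex_maxnP P0 Pub) => k /asboolP[U [UC dimU]] maxk.
suff UE : U = 'C(U)%VS by exists 'C(U)%AS; rewrite /= -UE.
apply/eqP; rewrite eqEsubv UC /=; apply/subvP => x xC; apply/negPn/negP => xNU.
suff : (k.+1 <= k)%N by rewrite ltnn.
apply: maxk; apply/asboolP; exists (U + <[x]>)%VS; split; last first.
  have nzx : x != 0 by apply: contraNneq xNU => ->; exact: mem0v.
  rewrite dimv_disjoint_sum ?dim_vline ?dimU ?nzx ?addn1 //.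
  apply/eqP; rewrite -subv0; apply/subvP => y /memv_capP[yU /vlineP[c yE]].
  rewrite memv0; move: yU; rewrite yE; have [->|c0] := eqVneq c 0; first by rewrite scale0r.
  by move/(memvZ c^-1); rewrite scalerA mulVf // scale1r (negPf xNU).
apply/centvsP => _ y /memv_addP[u uU [_ /vlineP[c ->] ->]].
move=> /memv_addP[v vU [_ /vlineP[d ->] ->]].
move/centvP: xC => xU; move/centvsP: UC => UC.
rewrite !mulrDl !mulrDr -!scalerAl -!scalerAr (UC _ _ uU vU) (xU _ uU) (xU _ vU).
by rewrite -!addrA; congr (_ + _); rewrite addrCA !scalerA mulrC.
Qed.

(** Semisimplicity splits [D] into a direct sum of left lines [K * <[b]>] with [b] nonzero; right
    multiplication by such a [b] is injective, so the generators form a left [K]-basis. *)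
Lemma skew_field_left_basis (K : {aspace D}) :
  exists m (b : 'I_m -> D),
    (forall x, exists k : 'I_m -> D, (forall i, k i \in K) /\ x = \sum_i k i * b i) /\
    (forall k : 'I_m -> D, (forall i, k i \in K) ->
       \sum_i k i * b i = 0 -> forall i, k i = 0).
Proof.
have [|X [spanX dX nzX]] := @skew_field_module_semisimple F D divD K fullv.
  exact: subvf.
pose b (i : 'I_(size X)) := X`_i.
have memKb (k : D) i : k \in K -> k * b i \in (K * <[b i]>)%VS.
  by move=> kK; rewrite memv_mul ?memv_line.
exists (size X), b; split.
  move=> x; have : x \in (\sum_i K * <[b i]>)%VS.
    by move: spanX; rewrite (big_nth 0) big_mkord => ->; rewrite memvf.
  case/memv_sumP => v vK ->.
  have vE i : exists k, k \in K /\ v i = k * b i.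
    have := vK i isT; rewrite -limg_amulr => /memv_imgP[k kK ->].
    by exists k; rewrite lfunE.
  have [k kP] := choice vE; exists k; split; first by move=> i; case: (kP i).
  by apply: eq_bigr => i _; case: (kP i).
move=> k kK sum0 i.
have dX' : directv (\sum_i K * <[b i]>).
  move/directvP: dX => /=; rewrite (big_nth 0) big_mkord => dX.
  apply/directvP => /=; rewrite dX.
  by rewrite (big_nth 0) big_mkord.
have /(_ (fun i => k i * b i) (fun i _ => memKb _ _ (kK i)) sum0 i isT) /eqP :=
  directv_sum_independent dX'.
have nzb : b i != 0 by apply: contraNneq nzX => <-; rewrite mem_nth.
by rewrite (mulIr_eq0 _ (mulIr (divD nzb))) => /eqP.
Qed.

(** * A commutative subalgebra as a field *)

Section SubfieldType.

Variable K : {aspace D}.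
Hypothesis commK : {in K &, commutative *%R}.

Fact subvs_comm_mulC : @commutative (subvs_of K) (subvs_of K) *%R.
Proof. by move=> x y; apply/val_inj/commK; apply: subvsP. Qed.

Fact subvs_comm_field : GRing.field_axiom (subvs_of K).
Proof. by move=> x nzx; apply/vsval_unitr/divD. Qed.

(** The field structure depends on the proof [commK], so it is packed as a term rather than declared
    as an instance on [subvs_of K]. *)
Definition comm_aspace_field : fieldType :=
  let cC := GRing.PzRing_hasCommutativeMul.Build (subvs_of K) subvs_comm_mulC in
  let cR : comUnitRingType := HB.pack (subvs_of K) cC in
  let fC := GRing.ComUnitRing_isField.Build cR subvs_comm_field in
  HB.pack cR fC.

Definition comm_aspace_incl (x : comm_aspace_field) : D := vsval (x : subvs_of K).

Fact comm_aspace_incl_zmod : zmod_morphism comm_aspace_incl.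
Proof. by move=> x y; rewrite /comm_aspace_incl -linearB. Qed.

Fact comm_aspace_incl_monoid : monoid_morphism comm_aspace_incl.
Proof. by split=> //; apply: skew_field_algid1. Qed.

HB.instance Definition _ :=
  GRing.isZmodMorphism.Build comm_aspace_field D comm_aspace_incl comm_aspace_incl_zmod.
HB.instance Definition _ :=
  GRing.isMonoidMorphism.Build comm_aspace_field D comm_aspace_incl comm_aspace_incl_monoid.

Definition comm_aspace_scalar (c : F) : comm_aspace_field := in_alg (subvs_of K) c.

Fact comm_aspace_scalar_zmod : zmod_morphism comm_aspace_scalar.
Proof. by move=> x y; apply: (raddfB (in_alg (subvs_of K))). Qed.

Fact comm_aspace_scalar_monoid : monoid_morphism comm_aspace_scalar.
Proof.
split=> [|x y]; first exact: (rmorph1 (in_alg (subvs_of K))).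
exact: (rmorphM (in_alg (subvs_of K))).
Qed.

HB.instance Definition _ :=
  GRing.isZmodMorphism.Build F comm_aspace_field comm_aspace_scalar comm_aspace_scalar_zmod.
HB.instance Definition _ :=
  GRing.isMonoidMorphism.Build F comm_aspace_field comm_aspace_scalar comm_aspace_scalar_monoid.

Lemma comm_aspace_inclK c : comm_aspace_incl (comm_aspace_scalar c) = c%:A.
Proof. by rewrite /comm_aspace_incl /comm_aspace_scalar /= skew_field_algid1. Qed.

End SubfieldType.

(** Presents the self-centralizing subalgebra as an abstract field, so that matrices over it can be
    formed. *)
Lemma exists_selfcentralizing_field :
  exists (K : fieldType) (inc : {rmorphism K -> D}) (iota : {rmorphism F -> K})
         (m : nat) (b : 'I_m -> D),
  [/\ forall c, inc (iota c) = c%:A,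
      forall x, (forall k, x * inc k = inc k * x) -> exists k, x = inc k,
      forall x, exists k : 'I_m -> K, x = \sum_i inc (k i) * b i &
      forall k : 'I_m -> K, \sum_i inc (k i) * b i = 0 -> forall i, k i = 0].
Proof.
have [K KE] := exists_selfcentralizing_aspace.
have commK : {in K &, commutative *%R} by apply/centvsP; rewrite -KE.
have [m [b [bspan bfree]]] := skew_field_left_basis K.
pose mk (x : D) (xK : x \in K) : comm_aspace_field commK := Subvs xK.
pose inc : {rmorphism comm_aspace_field commK -> D} := @comm_aspace_incl K commK.
pose iota : {rmorphism F -> comm_aspace_field commK} := @comm_aspace_scalar K commK.
exists (comm_aspace_field commK), inc, iota, m, b; split.
- exact: comm_aspace_inclK.
- move=> x xC; have xK : x \in K.
    by rewrite KE; apply/centvP => y yK; have := xC (mk y yK).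
  by exists (mk x xK).
- move=> x; have [k [kK ->]] := bspan x.
  by exists (fun i => mk (k i) (kK i)).
- move=> k k0 i; apply: (val_inj : injective (vsval : subvs_of K -> D)).
  exact: (bfree (fun i => vsval (k i : subvs_of K)) (fun i => subvsP _) k0).
Qed.

End Splitting.

(** * The matrix representation over a maximal subfield *)

Section SplittingRepresentation.

Variables (F : fieldType) (D : falgType F).
Hypothesis divD : is_division_ring D.
Hypothesis centerD : center D = base_field D.

(* Injectivity of D (x) D^op -> End_F(D) is [mulmap_independent]; both sides
   have dimension (dim D)^2. *)
Lemma mulmap_surjective (T : 'End(D)) :
  exists a : 'I_(\dim {:D}) -> D, forall z, T z = \sum_i a i * z * (vbasis {:D})`_i.
Proof.
set e := vbasis {:D}; set N := \dim _.
pose psi (a : {ffun 'I_N -> D}) : 'End(D) := \sum_(i < N) (amulr e`_i \o amull (a i))%VF.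
have psiE a z : psi a z = \sum_i a i * z * e`_i.
  by rewrite sum_lfunE; apply: eq_bigr => i _; rewrite comp_lfunE !lfunE.
have psi_lin : linear psi.
  move=> c a b; apply/lfunP => z; rewrite add_lfunE scale_lfunE !psiE.
  rewrite scaler_sumr -big_split; apply: eq_bigr => i _ /=.
  by rewrite !ffunE !mulrDl -!scalerAl.
pose psiM := GRing.isLinear.Build _ _ _ _ psi psi_lin.
pose psiL : {linear _ -> _} := HB.pack psi psiM.
have ker0 : lker (linfun psiL) == 0%VS.
  rewrite -subv0; apply/subvP => a; rewrite memv_ker lfunE /= => /eqP psi0.
  rewrite memv0; apply/eqP/ffunP => i; rewrite ffunE; move: i.
  apply: (mulmap_independent divD centerD (Y := fun i => e`_i)) => [|z].
    exact (elimT (@freeP _ _ _ e) (basis_free (vbasisP _))).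
  by rewrite -psiE [psi a]psi0 lfunE.
have : T \in limg (linfun psiL).
  suff -> : limg (linfun psiL) = fullv by rewrite memvf.
  apply/eqP; rewrite eqEdim subvf limg_dim_eq ?(eqP ker0) ?capv0 //.
  by rewrite !dimvf /dim /= card_ord /N dimvf.
by case/memv_imgP => a _ ->; exists a => z; rewrite lfunE -psiE.
Qed.

(** [phi x] is the matrix of right multiplication by [x] in a left [K]-basis of [D]. For the
    spanning clause, a [K]-linear map has the form given by [mulmap_surjective], and its left
    coefficients must centralize [K], hence lie in [K]. The last clause is [mulmap_descent]. *)
Lemma exists_splitting_representation :
  exists (K : fieldType) (iota : {rmorphism F -> K}) (m : nat)
         (phi : {rmorphism D -> 'M[K]_m.+1}),
  [/\ forall c x, phi (c *: x) = iota c *: phi x,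
      exists N (e : 'I_N -> D), forall M : 'M[K]_m.+1, exists a : 'I_N -> K,
        M = \sum_i a i *: phi (e i) &
      forall k (y : 'I_k -> D) x (a : 'I_k -> K), phi x = \sum_i a i *: phi (y i) ->
        exists r : 'I_k -> F, x = \sum_i r i *: y i].
Proof.
have [K [inc [iota [[|m] [b [inciota centK spanb freeb]]]]]] :=
  exists_selfcentralizing_field divD.
  have [k /eqP] := spanb 1.
  by rewrite big_ord0 oner_eq0.
have [co coE] := choice spanb.
(* [rv] and [cv] are the mutually inverse identifications of row vectors with elements of [D]. *)
pose rv (v : 'rV[K]_m.+1) : D := \sum_i inc (v 0 i) * b i.
pose cv (x : D) : 'rV[K]_m.+1 := \row_i co x i.
have cvK x : rv (cv x) = x.
  by rewrite [RHS]coE; apply: eq_bigr => i _; rewrite mxE.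
have rvB u v : rv (u - v) = rv u - rv v.
  by rewrite /rv -sumrB; apply: eq_bigr => i _; rewrite !mxE rmorphB mulrBl.
have rvZ k v : rv (k *: v) = inc k * rv v.
  by rewrite /rv mulr_sumr; apply: eq_bigr => i _; rewrite !mxE rmorphM mulrA.
have rv_inj : injective rv.
  move=> u v /eqP; rewrite -subr_eq0 -rvB => /eqP uv0.
  apply/eqP; rewrite -subr_eq0; apply/eqP/rowP => i; rewrite [RHS]mxE.
  exact: (freeb (fun i => (u - v) 0 i) uv0 i).
have rv0 : rv 0 = 0 by rewrite -(subrr 0) rvB subrr.
have rvN u : rv (- u) = - rv u by rewrite -(sub0r u) rvB rv0 sub0r.
have rvD u v : rv (u + v) = rv u + rv v by rewrite -{1}[v]opprK rvB rvN opprK.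
have rv_sum k (f : 'I_k -> 'rV[K]_m.+1) : rv (\sum_i f i) = \sum_i rv (f i).
  by apply: (big_morph rv rvD rv0).
pose phi (x : D) : 'M[K]_m.+1 := \matrix_i cv (b i * x).
have phiE v x : rv (v *m phi x) = rv v * x.
  rewrite mulmx_sum_row rv_sum /rv mulr_suml; apply: eq_bigr => i _.
  by rewrite -/(rv _) rvZ rowK cvK mulrA.
have mx_ext (A B : 'M[K]_m.+1) : (forall v, rv (v *m A) = rv (v *m B)) -> A = B.
  by move=> AB; apply/row_matrixP => i; rewrite !rowE; apply/rv_inj/AB.
have phi_zmod : zmod_morphism phi.
  by move=> x y; apply: mx_ext => v; rewrite mulmxBr rvB !phiE mulrBr.
have phi_monoid : monoid_morphism phi.
  split; first by apply: mx_ext => v; rewrite phiE mulmx1 mulr1.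
  by move=> x y; apply: mx_ext => v; rewrite mulmxA !phiE mulrA.
pose phiZ := GRing.isZmodMorphism.Build _ _ phi phi_zmod.
pose phiM := GRing.isMonoidMorphism.Build _ _ phi phi_monoid.
pose phiR : {rmorphism D -> 'M[K]_m.+1} := HB.pack phi phiZ phiM.
have phi_comb k (y : 'I_k -> D) (a : 'I_k -> K) v :
    rv (v *m \sum_i a i *: phi (y i)) = \sum_i inc (a i) * rv v * y i.
  rewrite mulmx_sumr rv_sum; apply: eq_bigr => i _.
  by rewrite -scalemxAr rvZ phiE mulrA.
exists K, iota, m, phiR; split.
- move=> c x; apply: mx_ext => v; rewrite -scalemxAr rvZ !phiE inciota.
  by rewrite mulr_algl scalerAr.
- exists (\dim {:D}), (fun i => (vbasis {:D})`_i) => M.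
  pose T z := rv (cv z *m M).
  have TK k z : T (inc k * z) = inc k * T z.
    rewrite /T -rvZ scalemxAl; congr (rv (_ *m M)).
    by apply: rv_inj; rewrite rvZ !cvK.
  have T_lin : linear T.
    move=> c x y; rewrite -[c *: T x]mulr_algl -inciota -TK -rvD -mulmxDl.
    rewrite inciota mulr_algl; congr (rv (_ *m M)).
    by apply: rv_inj; rewrite rvD !cvK.
  pose TM := GRing.isLinear.Build _ _ _ _ T T_lin.
  pose TL : {linear _ -> _} := HB.pack T TM.
  have [a aE] := mulmap_surjective (linfun TL).
  have TE z : T z = \sum_i a i * z * (vbasis {:D})`_i by rewrite -aE lfunE.
  have aK i : exists k, a i = inc k.
    (* Comparing [T (inc k * z)] with [inc k * T z] gives a relation whose coefficients are the
       commutators [a i * inc k - inc k * a i]; independence kills them. *)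
    apply: centK => k; apply/eqP; rewrite -subr_eq0; apply/eqP; move: i.
    apply: (mulmap_independent divD centerD (Y := fun i => (vbasis {:D})`_i)) => [|z].
      exact (elimT (@freeP _ _ _ (vbasis {:D})) (basis_free (vbasisP _))).
    transitivity (T (inc k * z) - inc k * T z); last by rewrite TK subrr.
    rewrite !TE mulr_sumr -sumrB; apply: eq_bigr => i _.
    by rewrite !mulrBl !mulrA.
  have [a' a'E] := choice aK; exists a'; apply: mx_ext => v.
  rewrite phi_comb; transitivity (T (rv v)).
    by rewrite /T; congr (rv (_ *m M)); apply: rv_inj; rewrite cvK.
  by rewrite TE; apply: eq_bigr => i _; rewrite a'E.
- move=> k y x a phix; apply: (mulmap_descent divD centerD (a := fun i => inc (a i))).
  by move=> z; rewrite -[in LHS](cvK z) -phiE [phi x]phix phi_comb cvK.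
Qed.

End SplittingRepresentation.

(** * Function classes closed under ring operations *)

Section FunctionClass.

Variables (K : fieldType) (T : Type) (P : (T -> K) -> Prop).
Hypothesis P_const : forall c, P (fun=> c).
Hypothesis P_add : forall f g, P f -> P g -> P (fun X => f X + g X).
Hypothesis P_mul : forall f g, P f -> P g -> P (fun X => f X * g X).

Lemma fclass_sum (I : finType) (f : I -> T -> K) :
  (forall i, P (f i)) -> P (fun X => \sum_i f i X).
Proof.
move=> Pf; elim: (index_enum I) => [|i s IHs].
  by under eq_fun do rewrite big_nil; apply: P_const.
by under eq_fun do rewrite big_cons; apply: P_add.
Qed.

Lemma fclass_prod (I : finType) (f : I -> T -> K) :
  (forall i, P (f i)) -> P (fun X => \prod_i f i X).
Proof.
move=> Pf; elim: (index_enum I) => [|i s IHs].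
  by under eq_fun do rewrite big_nil; apply: P_const.
by under eq_fun do rewrite big_cons; apply: P_mul.
Qed.

Lemma fclass_mulmx p q r (A : T -> 'M[K]_(p, q)) (B : T -> 'M[K]_(q, r)) :
    (forall i j, P (fun X => A X i j)) -> (forall i j, P (fun X => B X i j)) ->
  forall i j, P (fun X => (A X *m B X) i j).
Proof.
move=> PA PB i j; under eq_fun do rewrite mxE.
by apply: fclass_sum => k; apply: P_mul.
Qed.

Lemma fclass_det p (A : T -> 'M[K]_p) :
  (forall i j, P (fun X => A X i j)) -> P (fun X => \det (A X)).
Proof.
move=> PA; apply: fclass_sum => s; apply: P_mul; first exact: P_const.
exact: fclass_prod.
Qed.

End FunctionClass.

(** * Rational functions and Zariski closure in the general linear group *)

Section RationalFunctions.

Variables (K : fieldType) (m : nat).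
Local Notation M := 'M[K]_m.+1.

(* Regular functions on GL_(m+1); the values at singular matrices are junk,
   whence the last constructor. *)
Inductive ratfun : (M -> K) -> Prop :=
| ratfun_const c : ratfun (fun=> c)
| ratfun_coef i j : ratfun (fun X => X i j)
| ratfun_inv i j : ratfun (fun X => invmx X i j)
| ratfun_add f g : ratfun f -> ratfun g -> ratfun (fun X => f X + g X)
| ratfun_mul f g : ratfun f -> ratfun g -> ratfun (fun X => f X * g X)
| ratfun_ext f g : ratfun f -> {in unitmx, f =1 g} -> ratfun g.

Definition ratfun_mulmx := fclass_mulmx ratfun_const ratfun_add ratfun_mul.
Definition ratfun_det := fclass_det ratfun_const ratfun_add ratfun_mul.

(** The clause on inverses is what [ratfun_comp] needs in the case of [ratfun_inv]. *)
Definition ratmap (Phi : M -> M) : Prop :=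
  [/\ forall X, X \in unitmx -> Phi X \in unitmx,
      forall i j, ratfun (fun X => Phi X i j) &
      forall i j, ratfun (fun X => invmx (Phi X) i j)].

Lemma ratmap_id : ratmap id.
Proof. by split=> // i j; constructor. Qed.

Lemma ratmap_const U : U \in unitmx -> ratmap (fun=> U).
Proof. by move=> unitU; split=> // i j; constructor. Qed.

Lemma ratmap_inv Phi : ratmap Phi -> ratmap (fun X => invmx (Phi X)).
Proof.
move=> [unitPhi Phi_rat PhiV_rat]; split=> // [X /unitPhi|i j].
  by rewrite unitmx_inv.
by under eq_fun do rewrite invmxK.
Qed.

Lemma ratmap_mul Phi Psi : ratmap Phi -> ratmap Psi -> ratmap (fun X => Phi X *m Psi X).
Proof.
move=> [unitPhi Phi_rat PhiV_rat] [unitPsi Psi_rat PsiV_rat]; split.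
- by move=> X unitX; rewrite unitmx_mul unitPhi ?unitPsi.
- exact: ratfun_mulmx.
- move=> i j; apply: ratfun_ext (ratfun_mulmx PsiV_rat PhiV_rat i j) _ => X unitX.
  by rewrite -[invmx (_ *m _)]/((Phi X * Psi X)^-1) invrM ?unitPhi ?unitPsi.
Qed.

Lemma ratfun_comp f Phi : ratfun f -> ratmap Phi -> ratfun (fun X => f (Phi X)).
Proof.
move=> f_rat [unitPhi Phi_rat PhiV_rat].
elim: f_rat => [c|i j|i j|g h _ ? _ ?|g h _ ? _ ?|g h _ g_rat gh].
- exact: ratfun_const.
- exact: Phi_rat.
- exact: PhiV_rat.
- exact: ratfun_add.
- exact: ratfun_mul.
- by apply: ratfun_ext g_rat _ => X /unitPhi /gh.
Qed.

(** The Zariski closure of [S] in the general linear group, defined by vanishing of regular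
    functions. *)
Definition ratclosure (S : set M) : set M :=
  [set X | X \in unitmx /\
           forall f, ratfun f -> (forall Y, S Y -> f Y = 0) -> f X = 0]%classic.

Lemma sub_ratclosure S X : X \in unitmx -> S X -> ratclosure S X.
Proof. by move=> unitX SX; split=> // f _; apply. Qed.

(** Continuity of rational maps: a function vanishing on [T] pulls back along [Phi] to one vanishing
    on [S]. *)
Lemma ratclosure_map S T Phi X : ratmap Phi ->
  (forall Y, S Y -> ratclosure T (Phi Y)) -> ratclosure S X -> ratclosure T (Phi X).
Proof.
move=> Phi_rat ST [unitX Xcl]; split; first by case: Phi_rat => + _ _; apply.
move=> f f_rat f0; apply: (Xcl _ (ratfun_comp f_rat Phi_rat)) => Y /ST[_].
exact.
Qed.

(** Separate continuity suffices: with the second argument fixed in [S], the first moves to the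
    closure; then that first argument is fixed and the second one moves. *)
Lemma ratclosure_map2 S T (Phi : M -> M -> M) X Y :
    (forall Z, S Z -> Z \in unitmx) ->
    (forall Z, Z \in unitmx -> ratmap (Phi^~ Z)) ->
    (forall Z, Z \in unitmx -> ratmap (Phi Z)) ->
    (forall X Y, S X -> S Y -> ratclosure T (Phi X Y)) ->
  ratclosure S X -> ratclosure S Y -> ratclosure T (Phi X Y).
Proof.
move=> unitS rat_l rat_r ST clX; apply: ratclosure_map => [|Z SZ].
  by apply: rat_r; case: clX.
move: clX; apply: (@ratclosure_map _ _ (Phi^~ Z)); first exact/rat_l/unitS.
by move=> X' SX'; apply: ST.
Qed.

Lemma ratclosure_mulmx S X Y :
    (forall Z, S Z -> Z \in unitmx) ->
    (forall X Y, S X -> S Y -> S (X *m Y)) ->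
  ratclosure S X -> ratclosure S Y -> ratclosure S (X *m Y).
Proof.
move=> unitS SM; apply: (@ratclosure_map2 _ _ mulmx) => // [Z uZ|Z uZ|{}X {}Y SX SY].
- exact: ratmap_mul ratmap_id (ratmap_const uZ).
- exact: ratmap_mul (ratmap_const uZ) ratmap_id.
- by apply: sub_ratclosure; [rewrite unitmx_mul !unitS | exact: SM].
Qed.

Lemma ratclosure_commutator S T X Y :
    (forall Z, S Z -> Z \in unitmx) ->
    (forall X Y, S X -> S Y -> T (X *m Y *m invmx X *m invmx Y)) ->
  ratclosure S X -> ratclosure S Y -> ratclosure T (X *m Y *m invmx X *m invmx Y).
Proof.
move=> unitS STcomm.
apply: (@ratclosure_map2 _ _ (fun X Y => X *m Y *m invmx X *m invmx Y)) => //.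
- move=> Z uZ; do 3?[apply: ratmap_mul]; try exact/ratmap_inv/ratmap_const.
  + exact: ratmap_id.
  + exact: ratmap_const.
  + exact/ratmap_inv/ratmap_id.
- move=> Z uZ; do 3?[apply: ratmap_mul]; try exact/ratmap_inv/ratmap_const.
  + exact: ratmap_const.
  + exact: ratmap_id.
  + exact/ratmap_inv/ratmap_id.
- move=> {}X {}Y SX SY; apply: sub_ratclosure; last exact: STcomm.
  by rewrite !unitmx_mul !unitmx_inv !unitS.
Qed.

(* Weaker than being a polynomial function, but enough to extend a vanishing
   property one coordinate at a time. *)
Definition linepoly (g : M -> K) : Prop :=
  forall X Y, exists p : {poly K}, forall t, g (X + t *: Y) = p.[t].

Lemma linepoly_const c : linepoly (fun=> c).
Proof. by move=> X Y; exists c%:P => t; rewrite hornerC. Qed.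

Lemma linepoly_coef i j : linepoly (fun X => X i j).
Proof.
move=> X Y; exists ((X i j)%:P + (Y i j)%:P * 'X) => t.
by rewrite !mxE !hornerE mulrC.
Qed.

Lemma linepoly_add f g : linepoly f -> linepoly g -> linepoly (fun X => f X + g X).
Proof.
move=> f_lp g_lp X Y; have [[p pE] [q qE]] := (f_lp X Y, g_lp X Y).
by exists (p + q) => t; rewrite hornerD pE qE.
Qed.

Lemma linepoly_mul f g : linepoly f -> linepoly g -> linepoly (fun X => f X * g X).
Proof.
move=> f_lp g_lp X Y; have [[p pE] [q qE]] := (f_lp X Y, g_lp X Y).
by exists (p * q) => t; rewrite hornerM pE qE.
Qed.

Lemma linepoly_exp f k : linepoly f -> linepoly (fun X => f X ^+ k).
Proof.
move=> f_lp X Y; have [p pE] := f_lp X Y.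
by exists (p ^+ k) => t; rewrite horner_exp pE.
Qed.

Lemma linepoly_det p (A : M -> 'M[K]_p) :
  (forall i j, linepoly (fun X => A X i j)) -> linepoly (fun X => \det (A X)).
Proof. exact: fclass_det linepoly_const linepoly_add linepoly_mul _ _. Qed.

Lemma linepoly_adj i j : linepoly (fun X => (\adj X) i j).
Proof.
rewrite [X in linepoly X](_ : _ = fun X : M => cofactor X j i); last first.
  by apply/funext => X; rewrite mxE.
apply: linepoly_mul; first exact: linepoly_const.
apply: linepoly_det => k l.
rewrite [X in linepoly X](_ : _ = fun X : M => X (lift j k) (lift i l)).
  exact: linepoly_coef.
by apply/funext => X; rewrite !mxE.
Qed.

(** The only denominators are powers of the determinant, since [invmx X] is the adjugate divided by
    [\det X]. *)
Lemma ratfun_clear_denominator f : ratfun f ->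
  exists k g, linepoly g /\ {in unitmx, forall X, f X * \det X ^+ k = g X}.
Proof.
have det_lp : linepoly (fun X => \det X) by apply: linepoly_det linepoly_coef.
elim=> [c|i j|i j|f1 f2 _ [k1 [g1 [lp1 E1]]] _ [k2 [g2 [lp2 E2]]]
       |f1 f2 _ [k1 [g1 [lp1 E1]]] _ [k2 [g2 [lp2 E2]]]|f1 f2 _ [k [g [lp E]]] f12].
- by exists 0%N, (fun=> c); split=> [|X _]; [exact: linepoly_const|rewrite expr0 mulr1].
- by exists 0%N, (fun X => X i j); split=> [|X _]; [exact: linepoly_coef|rewrite expr0 mulr1].
- exists 1%N, (fun X => (\adj X) i j); split=> [|X uX]; first exact: linepoly_adj.
  by rewrite expr1 /invmx uX mxE mulrC mulrA divrr ?mul1r.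
- exists (k1 + k2)%N, (fun X => g1 X * \det X ^+ k2 + g2 X * \det X ^+ k1); split.
    by apply: linepoly_add; apply: linepoly_mul => //; apply: linepoly_exp.
  by move=> X uX; rewrite -E1 // -E2 // mulrDl -!mulrA -!exprD [(k2 + k1)%N]addnC.
- exists (k1 + k2)%N, (fun X => g1 X * g2 X); split; first exact: linepoly_mul.
  by move=> X uX; rewrite -E1 // -E2 // exprD mulrACA.
- by exists k, g; split=> // X uX; rewrite -f12 ?E.
Qed.

(** Coordinates are freed from [F] one at a time: after [j] rounds only those of index at least [j]
    must lie in [F]. Each round restricts [g] to a line in direction [e j], where it is a polynomial
    vanishing on the image of [F], hence zero. *)
Lemma linepoly_vanish (F : Type) (iota : F -> K) (N : nat) (e : 'I_N -> M) g :
    (forall p : {poly K}, (forall c, p.[iota c] = 0) -> p = 0) -> linepoly g ->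
    (forall r : 'I_N -> F, g (\sum_i iota (r i) *: e i) = 0) ->
  forall a : 'I_N -> K, g (\sum_i a i *: e i) = 0.
Proof.
move=> Finf g_lp g0 a.
suff /(_ N) : forall j (a : 'I_N -> K),
    (forall i : 'I_N, (j <= i)%N -> exists c, a i = iota c) -> g (\sum_i a i *: e i) = 0.
  by apply=> i; rewrite leqNgt ltn_ord.
elim=> [|j IHj] {}a aF.
  have [r rE] := choice (fun i => aF i (leq0n i)).
  by under eq_bigr do rewrite rE; apply: g0.
have [ltjN|leNj] := ltnP j N; last first.
  apply: IHj => i leji; have := leq_trans (ltn_ord i) leNj.
  by rewrite ltnNge leji.
pose i0 := Ordinal ltjN.
have [p pE] := g_lp (\sum_(i | i != i0) a i *: e i) (e i0).
have gE t : g (\sum_i (if i == i0 then t else a i) *: e i) = p.[t].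
  rewrite -pE; congr (g _); rewrite (bigD1 i0) //= eqxx addrC; congr (_ + _).
  by apply: eq_bigr => i /negPf ->.
have p0 : p = 0.
  apply: Finf => c; rewrite -gE; apply: IHj => i leji.
  have [_|nei] := eqVneq i i0; first by exists c.
  by apply: aF; rewrite ltn_neqAle leji andbT eq_sym.
transitivity p.[a i0]; last by rewrite p0 horner0.
by rewrite -gE; congr (g _); apply: eq_bigr => i _; case: eqVneq => [->|].
Qed.

Lemma ratclosure_full (F : nzRingType) (iota : F -> K) (N : nat) (e : 'I_N -> M)
    (S : set M) :
    (forall p : {poly K}, (forall c, p.[iota c] = 0) -> p = 0) ->
    (forall X, exists a : 'I_N -> K, X = \sum_i a i *: e i) ->
    (forall r : 'I_N -> F, let X := \sum_i iota (r i) *: e i in X \in unitmx -> S X) ->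
  forall X, X \in unitmx -> ratclosure S X.
Proof.
move=> Finf spane inS X uX; split=> // f /ratfun_clear_denominator[k [g [g_lp gE]]] f0.
(* The factor [\det X] makes [h] vanish also at singular [F]-combinations, where nothing is known
   about [f]. *)
pose h X := g X * \det X.
have h0 : h X = 0.
  have [a ->] := spane X.
  apply: (linepoly_vanish Finf (g := h)) => [|r].
    by apply: linepoly_mul => //; apply: linepoly_det linepoly_coef.
  rewrite /h; set Y := (\sum_i _); have [uY|] := boolP (Y \in unitmx).
    by rewrite -gE // f0 ?mul0r //; apply: inS.
  by rewrite unitmxE unitfE negbK => /eqP ->; rewrite mulr0.
have nz : \det X != 0 by rewrite -unitfE -unitmxE.
move/eqP: h0; rewrite /h -gE // -mulrA -exprSr mulf_eq0 expf_eq0 (negPf nz) andbF orbF.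
by move/eqP.
Qed.

End RationalFunctions.

(** * Transvections, the regular unipotent matrix and cyclic vectors *)

Section Transvections.

Variables (K : fieldType) (m : nat).
Local Notation M := 'M[K]_m.+1.

Definition transvection (i j : 'I_m.+1) (t : K) : M := 1%:M + t *: delta_mx i j.

Lemma transvectionD i j s t : i != j ->
  transvection i j s *m transvection i j t = transvection i j (s + t).
Proof.
move=> neij; rewrite /transvection mulmxDl mul1mx mulmxDr mulmx1 -scalemxAl -scalemxAr.
by rewrite mul_delta_mx_0 1?eq_sym // !scaler0 addr0 scalerDl -addrA [t *: _ + _]addrC.
Qed.

Lemma transvectionN i j t : i != j -> transvection i j t *m transvection i j (- t) = 1%:M.
Proof. by move=> neij; rewrite transvectionD // subrr /transvection scale0r addr0. Qed.

Lemma transvection_unit i j t : i != j -> transvection i j t \in unitmx.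
Proof. by move=> neij; case: (mulmx1_unit (transvectionN t neij)). Qed.

Lemma invmx_transvection i j t : i != j -> invmx (transvection i j t) = transvection i j (- t).
Proof.
move=> neij; have unit_t := transvection_unit t neij.
by rewrite -[RHS](mulKmx unit_t) transvectionN // mulmx1.
Qed.

(* diag(u, u^-1) in the plane of coordinates i and j. *)
Definition torus_mx (i j : 'I_m.+1) (u : K) : M :=
  transvection i j (u - 1) *m transvection j i 1 *m
  transvection i j (u^-1 - 1) *m transvection j i (- u).

(** This and its three variants track a combination of two matrix units through one transvection, so
    that the four factors of [torus_mx] can be applied by successive rewriting; the [C] forms swap
    the summands. *)
Lemma transvection_mull p i j (k : 'I_p) t a b : i != j ->
  transvection i j t *m (a *: delta_mx i k + b *: delta_mx j k) =
    (a + t * b) *: delta_mx i k + b *: delta_mx j k.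
Proof.
move=> neij; rewrite /transvection mulmxDl mul1mx -scalemxAl mulmxDr -!scalemxAr.
rewrite mul_delta_mx mul_delta_mx_0 1?eq_sym // scaler0 add0r scalerA scalerDl.
by rewrite addrAC.
Qed.

Lemma transvection_mullC p i j (k : 'I_p) t a b : i != j ->
  transvection i j t *m (a *: delta_mx j k + b *: delta_mx i k) =
    a *: delta_mx j k + (b + t * a) *: delta_mx i k.
Proof. by move=> neij; rewrite addrC transvection_mull // addrC. Qed.

Lemma transvection_mulr p i j (k : 'I_p) t a b : i != j ->
  (a *: delta_mx k i + b *: delta_mx k j) *m transvection i j t =
    a *: delta_mx k i + (b + t * a) *: delta_mx k j.
Proof.
move=> neij; rewrite /transvection mulmxDr mulmx1 -scalemxAr mulmxDl -!scalemxAl.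
rewrite mul_delta_mx mul_delta_mx_0 1?eq_sym // scaler0 addr0 scalerA scalerDl.
by rewrite addrA.
Qed.

Lemma transvection_mulrC p i j (k : 'I_p) t a b : i != j ->
  (a *: delta_mx k j + b *: delta_mx k i) *m transvection i j t =
    (a + t * b) *: delta_mx k j + b *: delta_mx k i.
Proof. by move=> neij; rewrite addrC transvection_mulr // addrC. Qed.

Lemma torus_mx_mull i j u : i != j -> u != 0 ->
  torus_mx i j u *m delta_mx i j = u *: delta_mx i j.
Proof.
move=> neij nzu; have neji : j != i by rewrite eq_sym.
rewrite /torus_mx -!mulmxA.
rewrite (_ : delta_mx i j = 0 *: delta_mx j j + 1 *: delta_mx i j); last first.
  by rewrite scale0r add0r scale1r.
rewrite transvection_mull // transvection_mullC // transvection_mull //.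
rewrite transvection_mullC // scalerDr !scalerA.
by congr (_ *: _ + _ *: _); field.
Qed.

Lemma torus_mx_mulr i j u : i != j -> u != 0 ->
  delta_mx i j *m torus_mx i j u = u^-1 *: delta_mx i j.
Proof.
move=> neij nzu; have neji : j != i by rewrite eq_sym.
rewrite /torus_mx !mulmxA.
rewrite (_ : delta_mx i j = 0 *: delta_mx i i + 1 *: delta_mx i j); last first.
  by rewrite scale0r add0r scale1r.
rewrite transvection_mulr // transvection_mulrC // transvection_mulr //.
rewrite transvection_mulrC // scalerDr !scalerA.
by congr (_ *: _ + _ *: _); field.
Qed.

(** Conjugation by diag(u, u^-1) multiplies the parameter of the transvection by [u ^+ 2], and the
    inverse transvection subtracts [t]. *)
Lemma transvection_commutator i j u t : i != j -> u != 0 ->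
  torus_mx i j u *m transvection i j t *m invmx (torus_mx i j u) *m
    invmx (transvection i j t) = transvection i j ((u ^+ 2 - 1) * t).
Proof.
move=> neij nzu; have neji : j != i by rewrite eq_sym.
have unitH : torus_mx i j u \in unitmx by rewrite !unitmx_mul !transvection_unit.
rewrite (_ : torus_mx i j u *m transvection i j t =
             transvection i j (u ^+ 2 * t) *m torus_mx i j u).
  by rewrite mulmxK // invmx_transvection // transvectionD // mulrBl mul1r.
rewrite /transvection mulmxDr mulmx1 mulmxDl mul1mx -scalemxAl -scalemxAr.
rewrite torus_mx_mull // torus_mx_mulr // !scalerA; congr (_ + _ *: _).
by field.
Qed.

(** Only the first [k] superdiagonal entries are set, which allows an induction from the identity to
    the regular unipotent matrix at [k = m]. *)
Definition unipotent_mx (k : nat) : M :=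
  \matrix_(i, j) ((i == j)%:R + ((i < k)%N && (j == i.+1 :> nat))%:R).

Lemma unipotent_mx0 : unipotent_mx 0 = 1%:M.
Proof. by apply/matrixP => i j; rewrite !mxE addr0. Qed.

(** The transvection adds row [k + 1] to row [k], and in [unipotent_mx k] both are still rows of the
    identity. *)
Lemma unipotent_mxS k : (k < m)%N ->
  unipotent_mx k.+1 = transvection (inord k) (inord k.+1) 1 *m unipotent_mx k.
Proof.
move=> ltkm; rewrite /transvection scale1r mulmxDl mul1mx; apply/matrixP => i j.
have kE : @inord m k = k :> nat by rewrite inordK // ltnS ltnW.
have k1E : @inord m k.+1 = k.+1 :> nat by rewrite inordK // ltnS.
rewrite [RHS]mxE [LHS]mxE [X in _ = X + _]mxE -addrA; congr (_ + _).
rewrite mxE (bigD1 (inord k.+1)) //= big1 => [|l nel]; last first.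
  by rewrite mxE (negPf nel) andbF mul0r.
rewrite !mxE eqxx andbT addr0 k1E [(k.+1 < k)%N]ltnNge leqnSn /= addr0.
rewrite -!val_eqE /= kE k1E ltnS leq_eqVlt.
have [->|neik] := eqVneq (i : nat) k; last by rewrite /= mul0r addr0.
by rewrite ltnn /= add0r mul1r eq_sym.
Qed.

(** Invertible exactly when the first basis row vector is cyclic for [X]. *)
Definition krylov_mx (X : M) : M := \matrix_i (delta_mx 0 0 *m X ^+ i : 'rV_m.+1).

Lemma krylov_unipotent_unit : krylov_mx (unipotent_mx m) \in unitmx.
Proof.
set P := unipotent_mx m.
have PE i j : P i j = (i == j)%:R + ((i < m)%N && (j == i.+1 :> nat))%:R by rewrite mxE.
(* Entries left of column [i] are left unspecified: those from column [i] on already make the Krylov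
   matrix lower triangular with unit diagonal. *)
have rowE i : (i <= m)%N -> forall j : 'I_m.+1, (i <= j)%N ->
    (delta_mx 0 0 *m P ^+ i : 'rV_m.+1) 0 j = (i == j :> nat)%:R.
  elim: i => [|i IHi] lti j leij.
    by rewrite expr0 mulmx1 mxE eqxx /= -val_eqE /= eq_sym.
  rewrite exprSr [_ *m _]mulmxA mxE.
  (* For [l] greater than [i] the first factor vanishes by induction; for [l] less than [i], column
     [j] lies beyond the superdiagonal entry of row [l]. *)
  have E (l : 'I_m.+1) : l != inord i ->
      (delta_mx 0 0 *m P ^+ i : 'rV_m.+1) 0 l * P l j = 0.
    rewrite -val_eqE /= inordK ?(leq_trans lti) // => neli.
    have [leil|ltli] := leqP i l.
      by rewrite IHi ?(ltnW lti) // eq_sym (negPf neli) mul0r.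
    rewrite PE -val_eqE /= (ltn_eqF (ltn_trans ltli leij)) add0r.
    by rewrite (gtn_eqF (leq_ltn_trans ltli leij)) andbF mulr0.
  rewrite (bigD1 (inord i)) //= (big1 _ _ _ E) addr0.
  have iE : @inord m i = i :> nat by rewrite inordK // (leq_trans lti).
  rewrite IHi ?iE ?(ltnW lti) // eqxx mul1r PE -val_eqE /= iE lti.
  by rewrite ltn_eqF // add0r eq_sym.
have trig : is_trig_mx (krylov_mx P).
  apply/is_trig_mxP => i j ltij.
  by rewrite mxE (rowE _ (leq_ord i) _ (ltnW ltij)) (ltn_eqF ltij).
rewrite unitmxE (det_trig trig) big1 ?unitr1 // => i _.
by rewrite mxE (rowE _ (leq_ord i) _ (leqnn i)) eqxx.
Qed.

(** A matrix commuting with [A] is determined by its effect on a cyclic vector. The coefficients are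
    those of the image of that vector under [X] in the Krylov basis. *)
Lemma krylov_centralizer (A X : M) : krylov_mx A \in unitmx -> A *m X = X *m A ->
  exists c : 'I_m.+1 -> K, X = \sum_i c i *: A ^+ i.
Proof.
move=> unitA AX; pose v : 'rV_m.+1 := delta_mx 0 0 *m X *m invmx (krylov_mx A).
have comX n : A ^+ n *m X = X *m A ^+ n.
  by apply/commr_sym/commrX.
exists (v 0); set Q := \sum_i _.
have comQ n : A ^+ n *m Q = Q *m A ^+ n.
  rewrite /Q mulmx_sumr mulmx_suml; apply: eq_bigr => i _.
  by rewrite -scalemxAr -scalemxAl -[_ *m _]exprD addnC exprD.
have e0Q : delta_mx 0 0 *m Q = delta_mx 0 0 *m X :> 'rV_m.+1.
  rewrite -[RHS](mulmxKV unitA) -/v [RHS]mulmx_sum_row mulmx_sumr.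
  by apply: eq_bigr => i _; rewrite rowK -scalemxAr.
rewrite -[LHS](mulKmx unitA) -[RHS](mulKmx unitA); congr (_ *m _).
apply/row_matrixP => i; rewrite !row_mul !rowK -!mulmxA comX comQ !mulmxA.
by rewrite e0Q.
Qed.

(** Makes cyclicity of the first basis vector an open condition. *)
Lemma ratfun_det_krylov : ratfun (fun X : M => \det (krylov_mx X)).
Proof.
apply: ratfun_det => i j.
rewrite [X in ratfun X](_ : _ = fun X : M => (delta_mx 0 0 *m X ^+ i : 'rV_m.+1) 0 j).
  elim: (i : nat) j => [|n IHn] j.
    by rewrite [X in ratfun X](_ : _ = fun=> (delta_mx 0 0 : 'rV_m.+1) 0 j);
      [exact: ratfun_const | apply/funext => X; rewrite expr0 mulmx1].
  rewrite [X in ratfun X](_ : _ = fun X : M => ((delta_mx 0 0 *m X ^+ n) *m X : 'rV_m.+1) 0 j);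
    last by apply/funext => X; rewrite exprSr [in LHS]mulmxA.
  apply: ratfun_mulmx => k l; last exact: ratfun_coef.
  by rewrite (ord1 k).
by apply/funext => X; rewrite mxE.
Qed.

(** * Unipotent elements in iterated commutator families *)

Section DerivedFamily.

Variables (Z : nat -> set M) (u : K).
Hypothesis Z0 : forall X, X \in unitmx -> Z 0 X.
Hypothesis ZM : forall n X Y, Z n X -> Z n Y -> Z n (X *m Y).
Hypothesis ZR : forall n X Y, Z n X -> Z n Y -> Z n.+1 (X *m Y *m invmx X *m invmx Y).
Hypotheses (u_neq0 : u != 0) (u_sqr : u ^+ 2 != 1).

Lemma derived_family_one n : Z n 1%:M.
Proof.
elim: n => [|n IHn]; first by apply: Z0; rewrite unitmx1.
by have := ZR IHn IHn; rewrite invmx1 !mulmx1.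
Qed.

(** By induction [Z n] contains all transvections, hence their product [torus_mx]; as [u ^+ 2 - 1]
    is invertible, every parameter [t] arises from a commutator in [Z n.+1]. *)
Lemma derived_family_transvection n i j t : i != j -> Z n (transvection i j t).
Proof.
elim: n i j t => [|n IHn] i j t neij; first exact/Z0/transvection_unit.
have neji : j != i by rewrite eq_sym.
have nz : u ^+ 2 - 1 != 0 by rewrite subr_eq0.
have -> : t = (u ^+ 2 - 1) * (t / (u ^+ 2 - 1)) by rewrite mulrC divfK.
rewrite -transvection_commutator //; apply: ZR; last exact: IHn.
by do 3?[apply: ZM]; apply: IHn.
Qed.

Lemma derived_family_unipotent n k : (k <= m)%N -> Z n (unipotent_mx k).
Proof.
elim: k => [|k IHk] lekm; first by rewrite unipotent_mx0; apply: derived_family_one.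
rewrite unipotent_mxS //; apply: ZM; last exact/IHk/ltnW.
apply: derived_family_transvection.
by rewrite -val_eqE /= !inordK ?ltnS ?(ltnW lekm) // ltn_eqF.
Qed.

End DerivedFamily.

End Transvections.

(** * Finite division rings and infinite base fields *)

Lemma finite_division_ring_commutative (R : unitRingType) (s : seq R) :
  is_division_ring R -> (forall x, x \in s) -> forall x y : R, x * y = y * x.
Proof.
move=> divR s_full.
have pickleK : pcancel (index^~ s) (onth s).
  by move=> x; rewrite onthE (nth_map x) ?index_mem ?nth_index.
have enumP : Finite.axiom (undup s).
  by move=> x; rewrite count_uniq_mem ?undup_uniq // mem_undup s_full.
pose cntR := Choice_isCountable.Build R pickleK.
pose cR : countType := HB.pack R cntR.
pose finR := isFinite.Build cR enumP.
pose fR : finUnitRingType := HB.pack R cntR finR.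
apply: (@finDomain_mulrC fR) => x y xy0.
have [//|/divR Ux /=] := eqVneq (x : R) 0.
by apply/eqP/(mulrI Ux); rewrite mulr0.
Qed.

Lemma finite_falgebra_enum (F : fieldType) (D : falgType F) (s : seq F) :
  (forall c, c \in s) -> exists t : seq D, forall x, x \in t.
Proof.
move=> s_full; pose e := vbasis {:D}.
exists [seq \sum_i val (f i) *: e`_i | f : {ffun 'I_(\dim {:D}) -> seq_sub s}] => x.
apply/mapP; exists [ffun i => SeqSub (s_full (coord e i x))]; first by rewrite mem_enum.
rewrite {1}(coord_vbasis (memvf x)); apply: eq_bigr => i _.
by rewrite ffunE.
Qed.

(** Infinitude is phrased by duplicate-free lists of every length, the form used for counting roots
    of polynomials. *)
Lemma seq_full_or_infinite (T : eqType) :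
  (exists s : seq T, forall x, x \in s) \/
  (forall n, exists s : seq T, uniq s /\ size s = n).
Proof.
have [?|nfull] := pselect (exists s : seq T, forall x, x \in s); [by left|right].
elim=> [|n [s [uniq_s size_s]]]; first by exists [::].
have [x xNs] : exists x, x \notin s.
  apply: contrapT => noX; apply: nfull; exists s => x.
  by apply: contrapT => /negP xNs; apply: noX; exists x.
by exists (x :: s); rewrite /= xNs size_s.
Qed.

Lemma infinite_poly_eq0 (F K : fieldType) (iota : {rmorphism F -> K}) :
    (forall n, exists s : seq F, uniq s /\ size s = n) ->
  forall p : {poly K}, (forall c, p.[iota c] = 0) -> p = 0.
Proof.
move=> Finf p p0; apply/eqP/negPn/negP => nzp.
have [s [uniq_s size_s]] := Finf (size p).
have /(_ nzp) := @max_poly_roots _ p [seq iota c | c <- s].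
rewrite size_map size_s ltnn map_inj_uniq //; last exact: fmorph_inj.
move=> /(_ _ uniq_s) absurd; suff : false by [].
by apply: absurd; apply/allP => _ /mapP[c _ ->]; apply/rootP.
Qed.

(** * The derived series of the multiplicative group *)

Section DerivedSeries.

Variable D : unitRingType.
Hypothesis divD : is_division_ring D.

Lemma Dstar_subgroup : is_mul_subgroup (Dstar D).
Proof.
split=> //= [|x y nzx nzy|x nzx].
- exact: oner_neq0.
- by apply: contra_neq nzy => xy0; apply: (mulrI (divD nzx)); rewrite xy0 mulr0.
- by apply: contraTneq (divD nzx) => V0; rewrite -unitrV V0 unitr0.
Qed.

Lemma derived_series_neq0 n x : derived_series D n x -> x != 0.
Proof.
elim: n x => [//|n IHn] x Dx; apply: (Dx (Dstar D)); split; first exact: Dstar_subgroup.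
move=> _ [a [b [/IHn nza /IHn nzb ->]]].
have [_ _ DM DV] := Dstar_subgroup.
by apply: (DM _ _ (DM _ _ (DM _ _ nza nzb) (DV _ nza)) (DV _ nzb)).
Qed.

Lemma derived_series_mul n x y :
  derived_series D n x -> derived_series D n y -> derived_series D n (x * y).
Proof.
case: n => [|n] Dx Dy; first by have [_ _ + _] := Dstar_subgroup; apply.
by move=> H genH; have [[_ _ HM _] _] := genH; apply: HM; [exact: Dx|exact: Dy].
Qed.

Lemma derived_series_commutator n x y : derived_series D n x -> derived_series D n y ->
  derived_series D n.+1 (mul_commutator x y).
Proof. by move=> Dx Dy H [_]; apply; exists x, y. Qed.

End DerivedSeries.

(** The hypothesis puts the centralizer [S] of [d] inside [F[d]], so [S] is commutative; being a
    centralizer, it is also closed under inverses. Hence [S] is the field [F(d)], and whatever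
    centralizes [S] commutes with [d] and lies in [S]. *)
Lemma centralizer_powers_maximal (F : fieldType) (D : falgType F) (d : D) :
    is_division_ring D ->
    (forall x, x * d = d * x -> exists k (r : 'I_k -> F), x = \sum_i r i *: d ^+ i) ->
  is_maximal_subfield (adjoin d).
Proof.
move=> divD cent_d; pose S : set D := centralizer [set d]%classic.
have SP x : S x <-> x * d = d * x by split=> [|xd _ ->//]; apply.
have inS k (r : 'I_k -> F) : S (\sum_i r i *: d ^+ i).
  apply/SP/commr_sym/commr_sum => i _.
  by rewrite /GRing.comm -scalerAr -scalerAl -exprS -exprSr.
have S_sub (K : set D) : is_subfield K -> (base_field D `|` [set d] `<=` K)%classic ->
    (S `<=` K)%classic.
  move=> [K1 KB KM _ _] genK x /SP/cent_d[k [r ->]].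
  have K0 : K 0 by rewrite -(subrr 1); apply: KB.
  have KD y z : K y -> K z -> K (y + z).
    move=> Ky Kz; have -> : y + z = y - (0 - z) by rewrite sub0r opprK.
    exact: KB Ky (KB _ _ K0 Kz).
  have KX n : K (d ^+ n).
    elim: n => [|n IHn]; first by rewrite expr0.
    by rewrite exprS; apply: KM => //; apply: genK; right.
  apply: big_ind => // i _; rewrite -mulr_algl; apply: KM => //.
  by apply: genK; left; exists (r i).
have S_field : is_subfield S.
  split.
  - by apply/SP; rewrite mul1r mulr1.
  - by move=> x y /SP xd /SP yd; apply/SP; rewrite mulrBl mulrBr xd yd.
  - by move=> x y /SP xd /SP yd; apply/SP; rewrite -mulrA yd mulrA xd mulrA.
  - by move=> x /SP xd; apply/SP/commr_sym/commrV/commr_sym.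
  - move=> x y /SP/cent_d[k [r ->]] /SP yd.
    apply/commr_sym/commr_sum => i _; rewrite /GRing.comm -scalerAr -scalerAl.
    by congr (_ *: _); apply: commrX.
have Sd : S d by apply/SP.
have genS : (base_field D `|` [set d] `<=` S)%classic.
  move=> x [[c _ <-]|->] //; apply/SP.
  by rewrite mulr_algl mulr_algr.
have -> : adjoin d = S.
  apply/seteqP; split=> x; first by apply; split.
  by move=> Sx K [K_field genK]; apply: S_sub Sx.
split=> //; apply/seteqP; split=> x.
  by move=> Sx y Sy; case: S_field => _ _ _ _; apply.
by move=> Cx; apply/SP/Cx.
Qed.

(** * Infinite center by density, then the general statement *)

Lemma exists_derived_maximal_infinite (F : fieldType) (D : falgType F) (n : nat) :
    is_division_ring D -> center D = base_field D ->
    (forall n, exists s : seq F, uniq s /\ size s = n) ->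
  exists a : D, derived_series D n a /\ is_maximal_subfield (adjoin a).
Proof.
move=> divD centerD Finf.
have [K [iota [m [phi [phiZ [N [e spane]] descent]]]]] :=
  exists_splitting_representation divD centerD.
have polyF := infinite_poly_eq0 (iota := iota) Finf.
have phi_unit x : x != 0 -> phi x \in unitmx by move/divD/(rmorph_unit phi).
pose S k : set 'M[K]_m.+1 := (phi @` derived_series D k)%classic.
have unitS k X : S k X -> X \in unitmx.
  by move=> [x Dx <-]; apply/phi_unit/(derived_series_neq0 divD Dx).
have SM k X Y : S k X -> S k Y -> S k (X *m Y).
  move=> [x Dx <-] [y Dy <-]; exists (x * y); last exact: rmorphM.
  exact: derived_series_mul.
have SR k X Y : S k X -> S k Y -> S k.+1 (X *m Y *m invmx X *m invmx Y).
  move=> [x Dx <-] [y Dy <-]; exists (mul_commutator x y).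
    exact: derived_series_commutator.
  have Ux := divD _ (derived_series_neq0 divD Dx).
  have Uy := divD _ (derived_series_neq0 divD Dy).
  by rewrite /mul_commutator !rmorphM !rmorphV.
have Z0 X : X \in unitmx -> ratclosure (S 0) X.
  move: X; apply: (ratclosure_full (iota := iota) (e := fun i => phi (e i))) => //.
  (* An [F]-combination of the [phi (e i)] is the image of an element of [D], nonzero as soon as the
     image is invertible. *)
  move=> r /=; rewrite (_ : \sum_i _ = phi (\sum_i r i *: e i)); last first.
    by rewrite rmorph_sum; apply: eq_bigr => i _; rewrite -phiZ.
  set x := \sum_i _ => Ux; exists x => //=.
  by apply: contraTneq Ux => ->; rewrite rmorph0 unitmxE det0 unitr0.
have ZM k X Y : ratclosure (S k) X -> ratclosure (S k) Y -> ratclosure (S k) (X *m Y).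
  exact: ratclosure_mulmx (unitS k) (SM k).
have ZR k X Y : ratclosure (S k) X -> ratclosure (S k) Y ->
    ratclosure (S k.+1) (X *m Y *m invmx X *m invmx Y).
  exact: ratclosure_commutator (unitS k) (SR k).
have [u u0 u2] : exists2 u : K, u != 0 & u ^+ 2 != 1.
  apply: contrapT => nou.
  (* If no [u] worked, this nonzero cubic would vanish on the whole image of the infinite field
     [F]. *)
  have /eqP : ('X * ('X ^+ 2 - 1) : {poly K}) = 0.
    apply: polyF => c; rewrite !hornerE; apply: contrapT => /eqP nz.
    apply: nou; exists (iota c); first by apply: contraNneq nz => ->; rewrite mul0r.
    by apply: contraNneq nz => c2; rewrite c2 subrr mulr0.
  rewrite mulf_eq0 polyX_eq0 /= -size_poly_eq0 size_XnsubC //.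
have [_ clP] := derived_family_unipotent Z0 ZM ZR u0 u2 n (leqnn m).
have [d Dd kry_d] : exists2 d, derived_series D n d & krylov_mx (phi d) \in unitmx.
  apply: contrapT => nod.
  (* Otherwise the Krylov determinant would vanish on [S n], hence on its closure, which contains
     the regular unipotent matrix. *)
  have := clP _ (ratfun_det_krylov K m); apply: contraPP => _ det0.
  have := krylov_unipotent_unit K m; rewrite unitmxE unitfE det0 ?eqxx //.
  move=> _ [d Dd <-]; apply/eqP/negPn/negP => nz.
  by apply: nod; exists d; rewrite // unitmxE unitfE.
exists d; split=> //; apply: centralizer_powers_maximal => // x xd.
have [|c phix] := krylov_centralizer kry_d (X := phi x).
  by rewrite -[LHS]rmorphM -[RHS]rmorphM xd.
exists m.+1; apply: (descent _ _ _ c).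
by rewrite phix; apply: eq_bigr => i _; rewrite rmorphXn.
Qed.

Theorem theorem7 (F : fieldType) (D : falgType F)
  (divD : is_division_ring D)
  (centerD : center D = base_field D)
  (n : nat) (n_gt0 : (0 < n)%N) :
  exists a : D, derived_series D n a /\ is_maximal_subfield (adjoin a).
Proof.
have [[s s_full]|Finf] := seq_full_or_infinite F; last first.
  exact: exists_derived_maximal_infinite.
have [t t_full] := finite_falgebra_enum D s_full.
have commD := finite_division_ring_commutative divD t_full.
exists 1; split.
  by case: n n_gt0 => // n _ H [[]].
apply: centralizer_powers_maximal => // x _.
(* [D] is commutative, so it equals its center [F], and each element is a scalar multiple of the
   zeroth power of 1. *)
have [y _ <-] : base_field D x by rewrite -centerD => y _; apply: commD.
by exists 1%N, (fun=> y); rewrite big_ord1 expr0.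
Qed.
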